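(* Let $n$ be a positive integer multiple of $10$ and $\varepsilon\in(0,1/10)$. Let $\boldsymbol{u}=(1/n,\dots,1/n)\in\mathbb{R}^n$ and $\boldsymbol{v}=(1/n,\dots,1/n,1/5,2/5)\in\mathbb{R}^{2+2n/5}$, where $1/n$ appears $2n/5$ times in $\boldsymbol{v}$ (so $\|\boldsymbol{u}\|_1=\|\boldsymbol{v}\|_1=1$). Let $A$ be the $n\times(2+2n/5)$ matrix with $A_{ij}=0$ if ($i\le n/2$ and $j\le 2n/5$) or ($i>n/2$ and $j=2+2n/5$), and $A_{ij}=1$ otherwise. Then, with input $(A,(\boldsymbol{u},\boldsymbol{v}))$, SK takes $\Omega(\log n-\log\varepsilon)$ iterations to output a matrix $B$ satisfying $\|\boldsymbol{r}(B)-\boldsymbol{u}\|_1+\|\boldsymbol{c}(B)-\boldsymbol{v}\|_1\le\varepsilon$.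
   Context: SK on input $(A,(\boldsymbol{u},\boldsymbol{v}))$: $A^{(0)}_{ij}=u_iA_{ij}/r_i(A)$; odd $k$: $A^{(k)}_{ij}=v_jA^{(k-1)}_{ij}/c_j(A^{(k-1)})$; even $k\ge2$: $A^{(k)}_{ij}=u_iA^{(k-1)}_{ij}/r_i(A^{(k-1)})$, with $r_i,c_j$ row/column sums. ''Takes $\Omega(T)$ iterations'' means that the least $k$ for which $A^{(k)}$ satisfies the error bound is at least $cT$ for an absolute constant $c>0$. *)

(* Defs.v *)
From HB Require Import structures.
From mathcomp Require Import all_boot all_order all_algebra.
From mathcomp Require Import all_classical all_reals all_analysis.

Set Implicit Arguments.
Unset Strict Implicit.
Unset Printing Implicit Defensive.

Import Order.TTheory GRing.Theory Num.Theory.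

Local Open Scope ring_scope.

Section SinkhornKnopp.
Variables (R : realType) (m n : nat).
Implicit Types (A : 'M[R]_(m, n)) (u : 'rV[R]_m) (v : 'rV[R]_n).

Definition row_sums A : 'rV[R]_m := \row_i \sum_j A i j.

Definition col_sums A : 'rV[R]_n := \row_j \sum_i A i j.

Definition row_scale u A : 'M[R]_(m, n) :=
  \matrix_(i, j) (u 0 i * A i j / row_sums A 0 i).

Definition col_scale v A : 'M[R]_(m, n) :=
  \matrix_(i, j) (v 0 j * A i j / col_sums A 0 j).

Fixpoint SK A u v (k : nat) : 'M[R]_(m, n) :=
  if k is k'.+1 then
    if odd k then col_scale v (SK A u v k') else row_scale u (SK A u v k')
  else row_scale u A.

End SinkhornKnopp.

(* The norm that MathComp-Analysis puts on matrices is the sup norm. *)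
Definition l1norm (R : realType) (n : nat) (x : 'rV[R]_n) : R :=
  \sum_j `|x 0 j|.

Definition SK_error (R : realType) (m n : nat) (B : 'M[R]_(m, n))
    (u : 'rV[R]_m) (v : 'rV[R]_n) : R :=
  l1norm (row_sums B - u) + l1norm (col_sums B - v).

Definition SK_iterations (R : realType) (m n : nat) (A : 'M[R]_(m, n))
    (u : 'rV[R]_m) (v : 'rV[R]_n) (eps : R) (k : nat) : Prop :=
  SK_error (SK A u v k) u v <= eps /\
  forall l : nat, SK_error (SK A u v l) u v <= eps -> (k <= l)%N.

(* The two column counts 2n/5 and 2 + 2n/5 are exact only when 5 %| n.  Ordinals
   start at 0, so the 1-based rows i <= n/2 are those with i < n %/ 2, and the
   1-based columns 1 + 2n/5 and 2 + 2n/5 have indices 2n/5 and 2n/5 + 1.        *)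
Definition hard_u (R : realType) (n : nat) : 'rV[R]_n :=
  \row_(i < n) n%:R^-1.

Definition hard_v (R : realType) (n : nat) : 'rV[R]_(2 + (2 * n) %/ 5)%N :=
  \row_(j < (2 + (2 * n) %/ 5)%N)
    if (j < (2 * n) %/ 5)%N then n%:R^-1
    else if (j == (2 * n) %/ 5 :> nat)%N then 1 / 5
    else 2 / 5.

Definition hard_A (R : realType) (n : nat) : 'M[R]_(n, (2 + (2 * n) %/ 5)%N) :=
  \matrix_(i < n, j < (2 + (2 * n) %/ 5)%N)
    if ((i < n %/ 2) && (j < (2 * n) %/ 5)
        || (n %/ 2 <= i) && (j == ((2 * n) %/ 5).+1 :> nat))%N
    then 0 else 1.

(* Main.v *)
Require Import Defs.
From mathcomp Require Import all_boot all_order all_algebra.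
From mathcomp Require Import all_classical all_reals all_analysis.
From mathcomp Require Import ring lra zify.

(** Every iterate is constant on the blocks of the pattern of [A], so after a
    column scaling it is determined by the ratio [t] between the mass that the
    upper and the lower rows put on column [2n/5 + 1].  A row scaling followed by
    a column scaling maps [t] to [t (2t + 3) / (3t + 2)], which multiplies
    [t - 1 >= 0] by a factor in [[2/3, 4/5]].  Initially [t] is of order [n], and
    the error is at least [(t - 1) / (8 (t + 1))]; so an error [eps] requires
    [(2/3)^j n <= O(eps)] after [j] rounds. *)

Import Order.TTheory GRing.Theory Num.Theory.

Local Open Scope ring_scope.

Lemma SK_odd_step (R : realType) m n (A : 'M[R]_(m, n)) u v k : ~~ odd k ->
  SK A u v k.+1 = col_scale v (SK A u v k).
Proof. by move=> /= ->. Qed.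

Lemma SK_even_step (R : realType) m n (A : 'M[R]_(m, n)) u v k : odd k ->
  SK A u v k.+1 = row_scale u (SK A u v k).
Proof. by move=> /= ->. Qed.

Section HardInstance.
Import numFieldNormedType.Exports.
Variable R : realType.
Implicit Types (m n k j : nat) (a b s d t eps : R).

(** * Sums of block-constant families *)

Lemma sum_ord_if_lt (V : zmodType) n h (x y : V) : (h <= n)%N ->
  \sum_(i < n) (if (i < h)%N then x else y) = x *+ h + y *+ (n - h).
Proof.
move=> hn; rewrite -(big_mkord xpredT (fun i => if (i < h)%N then x else y)).
rewrite (@big_cat_nat _ _ _ h) //=; congr (_ + _).
  rewrite (@eq_big_nat _ _ _ _ _ _ (fun=> x)) => [|i /andP[_ ->]//].
  by rewrite sumr_const_nat subn0.
rewrite (@eq_big_nat _ _ _ _ _ _ (fun=> y)) => [|i /andP[hi _]].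
  by rewrite sumr_const_nat.
by rewrite ltnNge hi.
Qed.

Lemma sum_ord_block (V : zmodType) q (x y z : V) :
  \sum_(j < (2 + q)%N)
    (if (j < q)%N then x else if (j == q :> nat)%N then y else z) =
  x *+ q + y + z.
Proof.
rewrite (big_ord_recr q.+1) (big_ord_recr q) /= !ltnn !eqxx.
rewrite ltnNge leqnSn /= gtn_eqF //; congr (_ + _ + _).
rewrite (eq_bigr (fun=> x)) => [|i _]; last by rewrite ltn_ord.
by rewrite sumr_const card_ord.
Qed.

(** * Scalings and error of block-constant matrices *)

Definition block_mx4 n a b s d : 'M[R]_(n, (2 + (2 * n) %/ 5)%N) :=
  \matrix_(i, j)
    if (i < n %/ 2)%N then
      if (j < (2 * n) %/ 5)%N then 0
      else if (j == (2 * n) %/ 5 :> nat)%N then a else b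
    else if (j < (2 * n) %/ 5)%N then s
      else if (j == (2 * n) %/ 5 :> nat)%N then d else 0.

Lemma hard_A_block n : hard_A R n = block_mx4 n 1 1 1 1.
Proof.
apply/matrixP => i j; rewrite !mxE.
have := ltn_ord j; set q := ((2 * n) %/ 5)%N => jq.
case: (ltnP i (n %/ 2)) => hi /=; case: (ltngtP j q) => hj //=;
  try (by rewrite ltn_eqF // ltnS ltnW); try by rewrite hj ltn_eqF.
by have -> : (j == q.+1 :> nat)%N by rewrite eqn_leq -(ltnS j) jq hj.
Qed.

Section Blocks.
Variable m : nat.
Hypothesis m_gt0 : (0 < m)%N.
(** Writing [n] as [10 * m] makes the divisions exact: [5 * m] upper rows, [5 * m] lower rows and
    [4 * m] narrow columns. *)
Let n := (10 * m)%N.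
Let M : R := m%:R.

Let M_gt0 : 0 < M. Proof. by rewrite ltr0n. Qed.
Let M_neq0 : M != 0. Proof. exact: lt0r_neq0. Qed.
Let half_n : (n %/ 2 = 5 * m)%N. Proof. by rewrite /n; lia. Qed.
Let co_half_n : (n - 5 * m = 5 * m)%N. Proof. by rewrite /n; lia. Qed.
Let half_le : (5 * m <= n)%N. Proof. by rewrite /n; lia. Qed.
Let cols_n : ((2 * n) %/ 5 = 4 * m)%N. Proof. by rewrite /n; lia. Qed.
Let nE : n%:R = 10 * M. Proof. by rewrite /n natrM. Qed.
Let mulr_half (x : R) : x *+ (5 * m) = 5 * M * x.
Proof. by rewrite -(mulr_natl x) natrM. Qed.
Let mulr_cols (x : R) : x *+ (4 * m) = 4 * M * x.
Proof. by rewrite -(mulr_natl x) natrM. Qed.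

Lemma row_sums_block a b s d (i : 'I_n) :
  row_sums (block_mx4 n a b s d) 0 i =
  if (i < 5 * m)%N then a + b else 4 * M * s + d.
Proof.
rewrite mxE; under eq_bigr do rewrite mxE half_n.
case: ifP => _; rewrite sum_ord_block cols_n.
  by rewrite mul0rn add0r.
by rewrite addr0 mulr_cols.
Qed.

Lemma col_sums_block a b s d (j : 'I_(2 + (2 * n) %/ 5)%N) :
  col_sums (block_mx4 n a b s d) 0 j =
  if (j < (2 * n) %/ 5)%N then 5 * M * s
  else if (j == (2 * n) %/ 5 :> nat)%N then 5 * M * (a + d) else 5 * M * b.
Proof.
rewrite mxE; under eq_bigr do rewrite mxE half_n.
rewrite sum_ord_if_lt // co_half_n -!mulrnDl mulr_half.
by case: ifP => _; [rewrite add0r|case: ifP => _; rewrite ?addr0].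
Qed.

Lemma row_scale_block a b s d :
  row_scale (hard_u R n) (block_mx4 n a b s d) =
  block_mx4 n (a / (10 * M * (a + b))) (b / (10 * M * (a + b)))
    (s / (10 * M * (4 * M * s + d))) (d / (10 * M * (4 * M * s + d))).
Proof.
apply/matrixP => i j; rewrite mxE row_sums_block !mxE half_n nE.
have E x y : (10 * M)^-1 * x / y = x / (10 * M * y).
  by rewrite [in RHS]invfM; ring.
by case: ifP => _; do 2?case: ifP => _; rewrite ?mulr0 ?mul0r // E.
Qed.

(** The blocks [b] and [s] are the only nonzero ones in their columns, so the scaling resets them to
    the target divided by [5 * M]. Only the split of the shared column between [a] and [d] survives,
    and its ratio [a / d] is unchanged. *)
Lemma col_scale_block a b s d : b != 0 -> s != 0 ->
  col_scale (hard_v R n) (block_mx4 n a b s d) =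
  block_mx4 n (a / (25 * M * (a + d))) (2 / (25 * M)) (1 / (50 * M ^+ 2))
    (d / (25 * M * (a + d))).
Proof.
move=> b0 s0; apply/matrixP => i j; rewrite mxE col_sums_block !mxE half_n nE.
have E x y : 1 / 5 * x / (5 * M * y) = x / (25 * M * y).
  rewrite !invfM; have -> : 25 = 5 * 5 :> R by ring.
  by rewrite invfM; ring.
case: (i < _)%N; case: (j < _)%N; try case: (j == _ :> nat);
  rewrite ?mulr0 ?mul0r ?E //; field; by rewrite M_neq0 ?s0 ?b0.
Qed.

Lemma SK_error_block a b s d :
  SK_error (block_mx4 n a b s d) (hard_u R n) (hard_v R n) =
  5 * M * `|a + b - (10 * M)^-1| + 5 * M * `|4 * M * s + d - (10 * M)^-1| +
  (4 * M * `|5 * M * s - (10 * M)^-1| + `|5 * M * (a + d) - 1 / 5| +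
   `|5 * M * b - 2 / 5|).
Proof.
rewrite /SK_error /l1norm; congr (_ + _).
  under eq_bigr => i _ do rewrite !mxE -/(row_sums _) nE.
  rewrite (eq_bigr (fun i : 'I_n => if (i < 5 * m)%N
    then `|a + b - (10 * M)^-1| else `|4 * M * s + d - (10 * M)^-1|)).
    by rewrite sum_ord_if_lt // co_half_n !mulr_half.
  move=> i _; have := row_sums_block a b s d i; rewrite mxE => ->.
  by case: ifP.
rewrite (eq_bigr (fun j : 'I_(2 + (2 * n) %/ 5)%N =>
  if (j < (2 * n) %/ 5)%N then `|5 * M * s - (10 * M)^-1|
  else if (j == (2 * n) %/ 5 :> nat)%N then `|5 * M * (a + d) - 1 / 5|
  else `|5 * M * b - 2 / 5|)).
  by rewrite sum_ord_block cols_n mulr_cols.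
move=> j _; have := col_sums_block a b s d j.
rewrite !mxE => ->; rewrite nE.
by case: ifP => _ //; case: ifP.
Qed.

(** * The iterates as a one-parameter recursion *)

Definition SK_odd_block t :=
  block_mx4 n (t / (25 * M * (t + 1))) (2 / (25 * M)) (1 / (50 * M ^+ 2))
    (1 / (25 * M * (t + 1))).

(** The parameter [t] is still the ratio [a / d] before the row scaling; the new ratio [a / d] of
    this block matrix is [ratio_step t]. *)
Definition SK_even_block t :=
  block_mx4 n (t / (10 * M * (3 * t + 2))) (2 * (t + 1) / (10 * M * (3 * t + 2)))
    (2 * (t + 1) / (40 * M ^+ 2 * (2 * t + 3))) (1 / (10 * M * (2 * t + 3))).

Definition ratio_step t : R := t * (2 * t + 3) / (3 * t + 2).

(** The starting value is [a / d] in [SKn 0], namely [10 * M * (4 * M + 1) / (20 * M)]; column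
    scaling preserves it. *)
Definition ratio j : R := iter j ratio_step (2 * M + 1 / 2).

Lemma ratio_stepB1 t : 1 <= t ->
  ratio_step t - 1 = (t - 1) * (2 * (t + 1) / (3 * t + 2)).
Proof. by move=> t1; rewrite /ratio_step; field; lra. Qed.

(** The factor [2 * (t + 1) / (3 * t + 2)] decreases from [4 / 5] at [t = 1] towards [2 / 3] at
    infinity. The lower bound gives slowness, the upper one convergence. *)
Lemma ratio_step_bounds t : 1 <= t ->
  2 / 3 * (t - 1) <= ratio_step t - 1 <= 4 / 5 * (t - 1).
Proof.
move=> t1; rewrite ratio_stepB1 // !(mulrC (t - 1)).
have c0 : 0 < 3 * t + 2 by lra.
apply/andP; split; apply: ler_wpM2r; rewrite ?subr_ge0 //.
  by rewrite ler_pdivlMr //; lra.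
by rewrite ler_pdivrMr //; lra.
Qed.

Lemma ratio_bounds j :
  (2 / 3) ^+ j * (3 / 2 * M) <= ratio j - 1 <= (4 / 5) ^+ j * (2 * M).
Proof.
elim: j => [|j /andP[lo up]].
  (* This turns the initial gap [2 * M - 1 / 2] into at least [3 / 2 * M]. *)
  have M1 : 1 <= M by rewrite ler1n.
  by rewrite !expr0 /ratio /=; lra.
have p0 : 0 <= (2 / 3) ^+ j * (3 / 2 * M).
  by apply: mulr_ge0; [apply: exprn_ge0; lra | move: M_gt0; lra].
have /ratio_step_bounds : 1 <= ratio j by lra.
rewrite -[ratio_step _]/(ratio j.+1) !exprS -(mulrA (2 / 3)) -(mulrA (4 / 5)).
set x := (_ ^+ j * _) in lo p0 *; set y := (_ ^+ j * _) in up *.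
by move: lo up p0; lra.
Qed.

Lemma ratio_ge1 j : 1 <= ratio j.
Proof.
have /andP[lo _] := ratio_bounds j; rewrite -subr_ge0; apply: le_trans lo.
by apply: mulr_ge0; [apply: exprn_ge0; lra | move: M_gt0; lra].
Qed.

Lemma row_scale_SK_odd_block t : 1 <= t ->
  row_scale (hard_u R n) (SK_odd_block t) = SK_even_block t.
Proof.
move=> t1; rewrite /SK_odd_block row_scale_block /SK_even_block.
by congr block_mx4; field; rewrite M_neq0 /=; repeat (apply/andP; split); nra.
Qed.

Lemma col_scale_SK_even_block t : 1 <= t ->
  col_scale (hard_v R n) (SK_even_block t) = SK_odd_block (ratio_step t).
Proof.
move=> t1; have [c2 c3] : 0 < 3 * t + 2 /\ 0 < 2 * t + 3 by lra.
rewrite /SK_even_block col_scale_block /SK_odd_block /ratio_step.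
- by congr block_mx4; field; rewrite M_neq0 /=;
    repeat (apply/andP; split); nra.
- by rewrite mulf_neq0 ?invr_eq0 ?mulf_neq0 ?M_neq0 //; lra.
- by rewrite mulf_neq0 ?invr_eq0 ?mulf_neq0 ?expf_neq0 ?M_neq0 //; lra.
Qed.

Local Notation SKn k := (SK (hard_A R n) (hard_u R n) (hard_v R n) k).

Lemma SK0_block :
  SKn 0 = block_mx4 n (1 / (20 * M)) (1 / (20 * M))
    (1 / (10 * M * (4 * M + 1))) (1 / (10 * M * (4 * M + 1))).
Proof.
rewrite /= hard_A_block row_scale_block.
by congr block_mx4; field; move: M_gt0; lra.
Qed.

(** The index starts at 1 because [SKn 0] has not yet been column-scaled and so lies in neither
    family of blocks. *)
Lemma SK_odd_iter j : SKn j.*2.+1 = SK_odd_block (ratio j).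
Proof.
elim: j => [|j IH].
  rewrite [LHS]/= -[row_scale _ _]/(SKn 0) SK0_block col_scale_block.
  - by rewrite /SK_odd_block /ratio /=; congr block_mx4; field;
      move: M_gt0; lra.
  - by rewrite mulf_neq0 ?oner_eq0 ?invr_eq0 //; move: M_gt0; lra.
  - by rewrite mulf_neq0 ?oner_eq0 ?invr_eq0 ?mulf_neq0 //; move: M_gt0; lra.
rewrite doubleS SK_odd_step; last by rewrite /= odd_double.
rewrite SK_even_step; last by rewrite /= odd_double.
rewrite IH.
by rewrite row_scale_SK_odd_block ?col_scale_SK_even_block ?ratio_ge1.
Qed.

Lemma SK_even_iter j : SKn j.*2.+2 = SK_even_block (ratio j).
Proof.
rewrite -row_scale_SK_odd_block ?ratio_ge1 // -SK_odd_iter.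
by rewrite SK_even_step //= odd_double.
Qed.

(** * Errors of the iterates *)

Local Notation err B := (SK_error B (hard_u R n) (hard_v R n)).

(** The last column alone suffices: its sum is [1 / 4] instead of [2 / 5]. This excludes [k = 0] for
    every admissible [eps]. *)
Lemma SK_error0 : 1 / 10 < err (SKn 0).
Proof.
rewrite SK0_block SK_error_block.
have -> : 5 * M * (1 / (20 * M)) - 2 / 5 = - (3 / 20) by field.
rewrite normrN (ger0_norm (_ : 0 <= 3 / 20 :> R)); last by lra.
apply: (@lt_le_trans _ _ (3 / 20)); first by lra.
by rewrite addrA lerDr !addr_ge0 ?mulr_ge0 ?normr_ge0 // ltW.
Qed.

(** Column sums are exact here. Each upper row exceeds its target, and each lower row misses it, by
    [e / (50 * M)], and there are [10 * M] rows. *)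
Lemma SK_odd_block_error t : 1 <= t ->
  err (SK_odd_block t) = 1 / 5 * ((t - 1) / (t + 1)).
Proof.
move=> t1; rewrite SK_error_block.
have t0 : t + 1 != 0 by lra.
set e := (t - 1) / (t + 1); have e0 : 0 <= e by apply: divr_ge0; lra.
have E0 : 0 <= e / (50 * M).
  by apply: divr_ge0 => //; move: M_gt0; lra.
have -> : t / (25 * M * (t + 1)) + 2 / (25 * M) - (10 * M)^-1 = e / (50 * M).
  by rewrite /e; field; rewrite M_neq0 t0.
have -> : 4 * M * (1 / (50 * M ^+ 2)) + 1 / (25 * M * (t + 1)) - (10 * M)^-1
   = - (e / (50 * M)) by rewrite /e; field; rewrite M_neq0 t0.
have -> : 5 * M * (1 / (50 * M ^+ 2)) - (10 * M)^-1 = 0 by field.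
have -> : 5 * M * (t / (25 * M * (t + 1)) + 1 / (25 * M * (t + 1))) - 1 / 5 = 0.
  by field; rewrite M_neq0 t0.
have -> : 5 * M * (2 / (25 * M)) - 2 / 5 = 0 by field.
by rewrite normrN normr0 (ger0_norm E0); field.
Qed.

(** Only the narrow columns and the last column are used. Since [3 * t + 2] and [2 * t + 3] are at
    most [3 * (t + 1)], each group contributes at least [(t - 1) / (15 * (t + 1))], and
    [2 / 15 >= 1 / 8]. *)
Lemma SK_even_block_error t : 1 <= t ->
  1 / 8 * ((t - 1) / (t + 1)) <= err (SK_even_block t).
Proof.
move=> t1; rewrite SK_error_block.
have [t0 [t2 t3]] : [/\ 0 < t + 1, 0 < 3 * t + 2 & 0 < 2 * t + 3] by split; lra.
set b := 2 * (t + 1) / (10 * _ * _); set s := 2 * (t + 1) / _.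
have Eb : 5 * M * b - 2 / 5 = - ((t - 1) / (5 * (3 * t + 2))).
  by rewrite /b; field; rewrite M_neq0 /=; lra.
have Es : 4 * M * (5 * M * s - (10 * M)^-1) = (t - 1) / (5 * (2 * t + 3)).
  by rewrite /s; field; rewrite M_neq0 /=; lra.
have lb : (t - 1) / (15 * (t + 1)) <= `|5 * M * b - 2 / 5|.
  rewrite Eb normrN; apply: le_trans (ler_norm _); apply: ler_wpM2l; first lra.
  by rewrite lef_pV2 ?posrE; lra.
have ls : (t - 1) / (15 * (t + 1)) <= 4 * M * `|5 * M * s - (10 * M)^-1|.
  apply: (@le_trans _ _ ((t - 1) / (5 * (2 * t + 3)))).
    by apply: ler_wpM2l; [lra | rewrite lef_pV2 ?posrE; lra].
  rewrite -Es; apply: ler_wpM2l; last exact: ler_norm.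
  by move: M_gt0; lra.
have le : 1 / 8 * ((t - 1) / (t + 1)) <= 2 * ((t - 1) / (15 * (t + 1))).
  have -> : 2 * ((t - 1) / (15 * (t + 1))) = 2 / 15 * ((t - 1) / (t + 1)).
    by field; lra.
  by apply: ler_wpM2r; [apply: divr_ge0; lra | lra].
set x := `|_ + b - _|; set y := `|_ + _ - (10 * M)^-1|; set z := `|_ - 1 / 5|.
have [x0 [y0 z0]] : [/\ 0 <= 5 * M * x, 0 <= 5 * M * y & 0 <= z].
  by split; rewrite ?mulr_ge0 ?normr_ge0 // ltW.
move: lb ls le x0 y0 z0; set e := (_ / (15 * _)).
set E := 1 / 8 * _; lra.
Qed.

Lemma SK_error_ge k :
  1 / 8 * ((ratio k./2 - 1) / (ratio k./2 + 1)) <= err (SKn k.+1).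
Proof.
have r1 := ratio_ge1 k./2; have := odd_double_half k.
case: (odd k) => kE; rewrite -{3}kE.
  by rewrite -[(true + _)%N]/(k./2.*2.+1) SK_even_iter SK_even_block_error.
rewrite -[(false + _)%N]/(k./2.*2) SK_odd_iter SK_odd_block_error //.
by apply: ler_wpM2r; [apply: divr_ge0; lra | lra].
Qed.

(** Convergence of [ratio j] to 1 ensures that a least successful index exists. *)
Lemma SK_error_small eps : 0 < eps -> exists k, err (SKn k) <= eps.
Proof.
move=> e0.
have [j hj] : exists j, (4 / 5) ^+ j * (2 * M) <= eps.
  have : ((fun j => (4 / 5 : R) ^+ j) @ \oo --> (0 : R))%classic.
    by apply: cvg_expr; rewrite ger0_norm; lra.
  move=> /cvgrPdist_le /(_ (eps / (2 * M))).
  have c0 : 0 < 2 * M by move: M_gt0; lra.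
  case=> [|N _ /(_ N (leqnn N))]; first exact: divr_gt0.
  rewrite /= sub0r normrN => /(le_trans (ler_norm _)) h.
  by exists N; rewrite -ler_pdivlMr.
exists j.*2.+1; rewrite SK_odd_iter SK_odd_block_error ?ratio_ge1 //.
have r1 := ratio_ge1 j; have /andP[_ up] := ratio_bounds j.
have : (ratio j - 1) / (ratio j + 1) <= ratio j - 1.
  by rewrite ler_pdivrMr; nra.
by move: hj up r1; lra.
Qed.

Lemma SK_error_le_growth eps k : 0 < eps -> eps < 1 / 10 ->
  err (SKn k) <= eps -> n%:R / eps <= 600 ^+ k.
Proof.
move=> e0 e1; case: k => [|k le_eps]; first by have := SK_error0; lra.
have := le_trans (SK_error_ge k) le_eps; set j := k./2.
have r1 := ratio_ge1 j; have /andP[lo _] := ratio_bounds j.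
have c0 : 0 < ratio j + 1 by lra.
rewrite mulrA ler_pdivrMr // => h.
(* With [r] for [ratio j], [h] rearranges to [(1 - 8 * eps) * (r - 1) <= 16 * eps], and
   [1 - 8 * eps > 1 / 5] because [eps < 1 / 10]. *)
have r80 : ratio j - 1 <= 80 * eps by nra.
have c1 : (3 / 2) ^+ j * (2 / 3) ^+ j = 1 :> R.
  by rewrite -exprMn (_ : 3 / 2 * (2 / 3) = 1) ?expr1n //; field.
have p0 : 0 < (3 / 2) ^+ j :> R by apply: exprn_gt0; lra.
have hM : 3 / 2 * M <= (3 / 2) ^+ j * (80 * eps).
  have := ler_wpM2l (ltW p0) (le_trans lo r80).
  by rewrite [leLHS]mulrA c1 mul1r.
(* With [n = 10 * M], [hM] gives [n / eps <= 1600 / 3 * (3 / 2) ^+ j]. The base 600 absorbs both the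
   constant, through the extra factor in [600 ^+ k.+1], and the base [3 / 2], as [j <= k]. *)
have hj : (3 / 2) ^+ j <= 600 ^+ k :> R.
  apply: (@le_trans _ _ (600 ^+ j)).
    by apply: lerXn2r; rewrite ?nnegrE; lra.
  by apply: ler_weXn2l; [rewrite ler1n | rewrite /j -divn2 leq_div].
have hje : (3 / 2) ^+ j * (80 * eps) <= 600 ^+ k * (80 * eps).
  by apply: ler_wpM2r => //; lra.
rewrite ler_pdivrMr // nE exprS.
have p6 : 0 < 600 ^+ k :> R by apply: exprn_gt0; rewrite ltr0n.
have := mulr_gt0 p6 e0; move: hM hje.
by set X := 600 ^+ k; set Y := _ ^+ j; lra.
Qed.

End Blocks.
End HardInstance.

Theorem theorem7p1 (R : realType) :
  exists2 c : R, 0 < c &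
    forall (n : nat) (eps : R),
      (0 < n)%N -> (10 %| n)%N -> 0 < eps -> eps < 1 / 10 ->
      exists2 k : nat,
        SK_iterations (hard_A R n) (hard_u R n) (hard_v R n) eps k &
        c * (ln n%:R - ln eps) <= k%:R.
Proof.
have l600 : 0 < ln (600 : R) by apply: ln_gt0; rewrite ltr1n.
(* The constant comes from taking logarithms in [n%:R / eps <= 600 ^+ k]. *)
exists (ln 600)^-1; first by rewrite invr_gt0.
move=> n eps n_gt0 /dvdnP[m nE] e0 e1.
rewrite mulnC in nE; subst n; have m_gt0 : (0 < m)%N by case: (m) n_gt0.
have ex_k := @SK_error_small R m m_gt0 eps e0.
case: (ex_minnP ex_k) => k le_k min_k; exists k => //.
have := @SK_error_le_growth R m m_gt0 eps k e0 e1 le_k.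
have nr0 : 0 < (10 * m)%:R :> R by rewrite ltr0n.
have p600 : 0 < 600 :> R by rewrite ltr0n.
rewrite -ler_ln; [|exact: divr_gt0|exact: exprn_gt0].
rewrite ln_div // (lnXn _ p600) => le_ln.
by rewrite mulrC ler_pdivrMr // (mulr_natl _ k).
Qed.
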